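(* Let $\beta>1$ be a real number with $\log\beta/\log2\notin\mathbb{Q}$. For $k\ge0$ let $A_k(\beta)=\{i\in\mathbb{N}:\omega(\beta^{-k})_i=1\}$ be the set of positions of the digit $1$ in the binary expansion of $\beta^{-k}$, and let \[ W=\{k\in\mathbb{N}: A_k(\beta)\text{ contains no 3-term arithmetic progression}\}. \] Then $W$ has natural density $0$, i.e. $\#(W\cap[1,N])/N\to0$. If moreover $\log\beta/\log 2$ is badly approximable, then for every $\varepsilon>0$, $\#(W\cap[1,N])=O_\varepsilon(N^{\varepsilon})$.
   Context: For $x\in[0,1]$, its binary expansion is the sequence $\omega(x)=(\omega(x)_i)_{i\ge1}\in\{0,1\}^{\mathbb{N}}$ with $x=\sum_{i\ge1}\omega(x)_i2^{-i}$; when two such sequences exist, $\omega(x)$ is chosen to be the one with only finitely many $1$'s. A 3-term arithmetic progression in a set $A\subset\mathbb{N}$ means $a,a+d,a+2d\in A$ with $d\ge1$. A real number is badly approximable if the partial quotients of its continued fraction expansion are bounded. *)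

(* Defs.v *)
From Stdlib Require Import Reals Lra Lia ZArith Arith QArith Classical ClassicalEpsilon.
Open Scope R_scope.

Definition floorZ (x : R) : Z := Int_part x.

(* i-th binary digit (i >= 1) of x in [0,1]; for x < 1 the floor formula gives
   the expansion with finitely many 1's; x = 1 has the unique expansion 0.111... *)
Definition bin_digit (x : R) (i : nat) : Z :=
  if Req_EM_T x 1 then 1%Z
  else Z.modulo (floorZ (2 ^ i * x)) 2.

Definition A_set (beta : R) (k : nat) (i : nat) : Prop :=
  (1 <= i)%nat /\ bin_digit (/ (beta ^ k)) i = 1%Z.

Definition has_3AP (S : nat -> Prop) : Prop :=
  exists a d : nat, (1 <= d)%nat /\ S a /\ S (a + d)%nat /\ S (a + 2 * d)%nat.

Definition W_set (beta : R) (k : nat) : Prop := ~ has_3AP (A_set beta k).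

Definition count_upto (P : nat -> Prop) (N : nat) : nat :=
  List.fold_right (fun k acc => (if excluded_middle_informative (P k) then 1 else 0) + acc)%nat
    0%nat (List.seq 1 N).

Definition irrational (x : R) : Prop := forall q : Q, x <> Q2R q.

Fixpoint cf_rem (x : R) (n : nat) : R :=
  match n with
  | O => x
  | S m => / (cf_rem x m - IZR (floorZ (cf_rem x m)))
  end.
Definition partial_quotient (x : R) (n : nat) : Z := floorZ (cf_rem x n).

Definition badly_approximable (x : R) : Prop :=
  exists M : R, forall n : nat, Rabs (IZR (partial_quotient x n)) <= M.

(* Main.v *)
(* Let theta = ln beta / ln 2 and let e be the exponent with
   1 <= 2^e beta^-k < 2.  If k is in W, then for every n the n digits of beta^-k
   from position e on form a progression-free word.  By Roth's theorem there are
   only 2^o(n) such words.  If j theta stays at distance at least c/q from the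
   integers for 0 < j < q, then these words are distinct for distinct k in an
   interval of length q, as soon as 2^n exceeds a constant times q, so the interval
   contains at most O(q^eps) elements of W.  A badly approximable theta allows every
   q = N; an irrational theta allows arbitrarily large q with c = 1/2, which gives
   density 0.

   Roth's theorem is proved by Szemeredi's cube argument.  A set A in [0, 4n) of
   nearly maximal density contains, in [n, 2n), an affine cube with bounded
   differences.  The points 2m - x, for x in A below n and m in the subcube spanned by
   the first i differences, avoid A and form an increasing family F_i with
   F_(i+1) = F_i u (F_i + 2d).  Some step of a long chain adds few points; then F_i is
   almost invariant under translation by 2d, so that A fills the complement of F_i
   with at most the maximal density, too little to make up for F_i. *)
Require Import Defs.
From Stdlib Require Import ZArith QArith Reals Lra Lia Classical ClassicalEpsilon.
From mathcomp Require all_boot zify_ssreflect.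
Open Scope R_scope.

(* The module confines the MathComp reading of [<=] on [nat]. *)
Module ProgressionFreeDigits.

Import all_boot zify_ssreflect.
Set Implicit Arguments. Unset Strict Implicit. Unset Printing Implicit Defensive.
Local Open Scope nat_scope.
Implicit Types P Q A B F : nat -> bool.

(** * Counting in initial segments *)

Definition cnt (P : nat -> bool) N := \sum_(0 <= x < N) P x.
Definition ap_free (A : nat -> bool) :=
  forall a d, 0 < d -> A a -> A (a + d) -> A (a + 2 * d) -> False.

Lemma cnt0 P : cnt P 0 = 0. Proof. by rewrite /cnt big_geq. Qed.
Lemma cntS P N : cnt P N.+1 = cnt P N + P N.
Proof. by rewrite /cnt big_nat_recr. Qed.

Lemma cnt_le P Q N : (forall x, x < N -> P x -> Q x) -> cnt P N <= cnt Q N.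
Proof.
elim: N => [|N IH] PQ; first by rewrite !cnt0.
rewrite !cntS leq_add ?IH //; first by move=> x xN; apply: PQ; lia.
by have := PQ N (ltnSn N); case: (P N) => // ->.
Qed.

Lemma cnt_leN P N : cnt P N <= N.
Proof. by elim: N => [|N IH]; rewrite ?cnt0 // cntS; case: (P N); lia. Qed.

Lemma cnt_orb P Q N : cnt (fun x => P x || Q x) N <= cnt P N + cnt Q N.
Proof.
elim: N => [|N IH]; rewrite ?cnt0 // !cntS.
by move: IH; case: (P N); case: (Q N) => /=; lia.
Qed.

Lemma cnt_split P Q N :
  cnt P N = cnt (fun x => Q x && P x) N + cnt (fun x => ~~ Q x && P x) N.
Proof.
elim: N => [|N IH]; rewrite ?cnt0 // !cntS IH.
by case: (P N); case: (Q N) => /=; lia.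
Qed.

Lemma cnt_shift P d N : cnt (fun x => P (x + d)) N + cnt P d = cnt P (d + N).
Proof.
elim: N => [|N IH]; first by rewrite cnt0 addn0.
by rewrite addnS !cntS -IH addnAC (addnC N d).
Qed.

Lemma cnt_mono P m n : m <= n -> cnt P m <= cnt P n.
Proof.
move=> mn; rewrite -(subnKC mn) -cnt_shift; lia.
Qed.

Lemma cnt_rev P n : cnt (fun x => (x < n) && P (n.-1 - x)) n = cnt P n.
Proof.
rewrite /cnt [RHS]big_nat_rev /= add0n; apply: eq_big_nat => x /andP[_ xn].
by rewrite xn; congr (nat_of_bool (P _)); lia.
Qed.

(** An element N of [I] excludes the D numbers before it, so strong induction can jump from N to N -
    D. *)
Lemma cnt_sparse (I : nat -> bool) D :
  (forall x d, 0 < d <= D -> I x -> ~~ I (x + d)) ->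
  forall N, D.+1 * cnt I N <= N + D.
Proof.
move=> sp; elim/ltn_ind => -[_|N IH]; first by rewrite cnt0; lia.
rewrite cntS; case IN: (I N); last by have := IH N (ltnSn N); lia.
have -> : cnt I N = cnt I (N - D).
  have [DN|ND] := leqP D N; last first.
    rewrite (_ : N - D = 0); last by lia.
    rewrite cnt0 /cnt big_nat big1 // => x /= xN.
    case Ix: (I x) => //; have := @sp x (N - x) _ Ix.
    by rewrite (_ : x + (N - x) = N) ?IN //; [move/(_ ltac:(lia))|lia].
  rewrite -{1}(subnK DN) -cnt_shift /cnt big_nat big1 // => x /= xD.
  case Ix: (I _) => //; have := @sp _ (D - x) _ Ix.
  by rewrite (_ : _ + _ = N) ?IN //; [move/(_ ltac:(lia))|lia].
have [DN|ND] := leqP D N; first by have := IH (N - D) ltac:(lia); lia.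
by rewrite (_ : N - D = 0) ?cnt0; lia.
Qed.

(** Pigeonhole over the differences up to 2q. Points of [B] with no further point of [B] within
    distance 2q are sparse, fewer than 3N/(4q). If every difference were rare, the remaining points
    would number less than N/(4q), and the total would fall short of N/q. *)
Lemma cnt_common_difference q B N : 0 < q -> 4 * q <= N -> N <= q * cnt B N ->
  exists2 d, 0 < d <= 2 * q & N <= 8 * q * q * cnt (fun x => B x && B (x + d)) N.
Proof.
move=> q0 qN BN; set D := 2 * q.
have [/hasP[d dD dB]|/hasPn none] := boolP
  (has (fun d => N <= 8 * q * q * cnt (fun x => B x && B (x + d)) N) (iota 1 D)).
  by exists d => //; move: dD; rewrite mem_iota; lia.
pose I x := B x && ~~ has (fun d => B (x + d)) (iota 1 D).
have spI : D.+1 * cnt I N <= N + D.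
  apply: cnt_sparse => x d dD /andP[_ /hasPn nB].
  rewrite negb_and (negbTE (nB d _)) ?orbT //; last by rewrite mem_iota; lia.
have : cnt B N <= cnt I N + \sum_(d <- iota 1 D) cnt (fun x => B x && B (x + d)) N.
  rewrite /cnt exchange_big /= -big_split /=; apply: leq_sum => x _.
  rewrite /I; case: (B x) => //=.
  case: hasP => [[d dD Bd]|//] /=; rewrite (big_rem d) //= Bd; lia.
have : 8 * q * q * (\sum_(d <- iota 1 D) cnt (fun x => B x && B (x + d)) N) <= D * N.-1.
  rewrite big_distrr /= -{2}(size_iota 1 D) -sum1_size big_distrl /= big_seq [leqRHS]big_seq.
  by apply: leq_sum => d /none; lia.
set s := \sum_(_ <- _) _ => hs hb.
have h1 : 4 * q * s <= N.-1.
  have q20 : 0 < 2 * q by lia.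
  rewrite -(leq_pmul2l q20); apply: leq_trans hs; apply: eq_leq.
  by rewrite !mulnA; congr (_ * _); lia.
have h2 : q * cnt B N <= q * cnt I N + q * s by rewrite -mulnDr leq_mul2l hb orbT.
by rewrite /D in spI; lia.
Qed.

(** * Roth's theorem *)

(* All sums of [a] and a sublist of [ds] lie in [A]. *)
Fixpoint cube A (ds : seq nat) a :=
  if ds is d :: ds' then cube A ds' a && cube A ds' (a + d) else A a.

Lemma cube_and A d ds a :
  cube (fun x => A x && A (x + d)) ds a = cube A (d :: ds) a.
Proof.
elim: ds a => [//|e ds IH] a /=.
by rewrite !IH /= (addnAC a e); do 4!case: (cube _ _ _).
Qed.

Lemma eq_cube A B ds a : A =1 B -> cube A ds a = cube B ds a.
Proof. by move=> AB; elim: ds a => [|d ds IH] a /=; rewrite ?IH ?AB. Qed.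

(** Passing from [B] to the points x with x and x + d in [B] adds the generator d and lowers the
    density from 1/q to 1/(8q^2); this is iterated k times. The bounds [D] and [n0] depend on k and
    q only. *)
Lemma hilbert_cube k q : 0 < q -> exists D n0, forall B N, n0 <= N ->
  N <= q * cnt B N -> exists ds a,
  [/\ size ds = k, all (fun d => 0 < d <= D) ds, a < N & cube B ds a].
Proof.
elim: k q => [|k IH] q q0.
  exists 0, 1 => B N N0 BN; have : has B (iota 0 N).
    rewrite has_count; have : cnt B N = count B (iota 0 N).
      by rewrite /cnt /index_iota subn0; elim: (iota 0 N) => [|x s]; rewrite ?big_nil ?big_cons //= => ->.
    by move=> <-; case: (cnt B N) BN => //; rewrite muln0; lia.
  by move=> /hasP[a]; rewrite mem_iota => aN Ba; exists [::], a; split => //; lia.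
have [|D [n0 H]] := IH (8 * q * q); first by rewrite !muln_gt0 q0.
exists (maxn D (2 * q)), (maxn n0 (4 * q)) => B N; rewrite geq_max => /andP[n0N qN] BN.
have [d dq dN] := cnt_common_difference q0 qN BN.
have [ds [a [sz ds_le aN cub]]] := H _ _ n0N dN.
exists (d :: ds), a; split=> //=; first by rewrite sz.
  apply/andP; split; first by lia.
  by apply: sub_all ds_le => e; lia.
by rewrite cube_and in cub.
Qed.

(* The points [2m - x] with [x < n] in [A] and [m] in the cube spanned by [ds] at [a]. *)
Fixpoint mirror A n (ds : seq nat) a y :=
  if ds is d :: ds' then mirror A n ds' a y || mirror A n ds' (a + d) y
  else [&& y <= 2 * a, 2 * a - y < n & A (2 * a - y)].

(** Moving the centre by d moves the reflected point by 2d. Hence the mirror set of [d :: ds]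
    contains F + 2d, where F is that of [ds]. *)
Lemma mirror_shift A n ds a d y :
  mirror A n ds (a + d) (y + 2 * d) = mirror A n ds a y.
Proof.
elim: ds a => [|e ds IH] a /=; last by rewrite (addnAC a d) !IH.
by rewrite mulnDr leq_add2r subnDr.
Qed.

Lemma mirrorP A B n ds a y : cube B ds a -> mirror A n ds a y ->
  exists x m, [/\ x < n, A x, B m & x + y = 2 * m].
Proof.
elim: ds a => [|d ds IH] a /=.
  by move=> Ba /and3P[ya xn Ax]; exists (2 * a - y), a; split=> //; lia.
by move=> /andP[c1 c2] /orP[]; [apply: IH c1|apply: IH c2].
Qed.

(** The centre [a] alone reflects the points of [A] below n injectively, and [n <= a] keeps their
    images nonnegative. *)
Lemma cnt_mirror A n ds a N : n <= a -> 2 * a < N ->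
  cnt A n <= cnt (mirror A n ds a) N.
Proof.
move=> na aN; apply: (@leq_trans (cnt (mirror A n [::] a) N)); last first.
  by apply: cnt_le => x _; elim: ds => // d ds IH /IH /= ->.
rewrite -cnt_rev.
have -> : cnt (fun x => (x < n) && A (n.-1 - x)) n =
          cnt (fun x => (x < n) && mirror A n [::] a (x + (2 * a - n.-1))) n.
  rewrite /cnt; apply: eq_big_nat => x /andP[_ xn] /=; rewrite xn.
  have -> : 2 * a - (x + (2 * a - n.-1)) = n.-1 - x by lia.
  by have [-> ->] : x + (2 * a - n.-1) <= 2 * a /\ n.-1 - x < n by lia.
apply: (@leq_trans (cnt (mirror A n [::] a) (2 * a - n.-1 + n))); last by apply: cnt_mono; lia.
by rewrite -cnt_shift; apply: leq_trans (leq_addr _ _); apply: cnt_le => x _ /andP[].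
Qed.

(** Pigeonhole on the suffixes of [ds]: their mirror sets increase with the suffix, and [size ds]
    steps that each add g points below N would add more than N. *)
Lemma slow_growth A n ds a N g : N < g * size ds ->
  exists d ds', [/\ d \in ds, forall B, cube B ds a -> cube B (d :: ds') a &
    cnt (mirror A n (d :: ds') a) N < cnt (mirror A n ds' a) N + g].
Proof.
move=> Ng.
suff [//|H] : (exists d ds', [/\ d \in ds, forall B, cube B ds a -> cube B (d :: ds') a &
    cnt (mirror A n (d :: ds') a) N < cnt (mirror A n ds' a) N + g]) \/
    g * size ds <= cnt (mirror A n ds a) N.
  by have := cnt_leN (mirror A n ds a) N; lia.
elim: ds {Ng} => [|d ds [[e [ds' [h1 h2 h3]]]|IH]]; first by right; rewrite muln0.
  left; exists e, ds'; split=> // [|B /andP[cB _]]; [by rewrite inE h1 orbT|exact: h2].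
have [lt|ge] := ltnP (cnt (mirror A n (d :: ds) a) N) (cnt (mirror A n ds a) N + g).
  by left; exists d, ds; rewrite mem_head.
by right; apply: leq_trans ge; rewrite mulnS addnC leq_add2r.
Qed.

(** A point that is outside F after j translations by D left F at one of them, and each translation
    accounts for at most g points. *)
Lemma cnt_drift F N D g j : (forall x, F x -> x < N) ->
  cnt (fun y => F y && ~~ F (y + D)) N <= g ->
  cnt (fun y => F y && ~~ F (y + j * D)) N <= j * g.
Proof.
move=> FN Fg; elim: j => [|j IH].
  by rewrite mul0n leqn0 /cnt big1 // => x _; rewrite addn0 andbN.
have step : cnt (fun y => F (y + j * D) && ~~ F (y + j * D + D)) N <=
            cnt (fun y => F y && ~~ F (y + D)) N.
  pose P y := F y && ~~ F (y + D).
  apply: leq_trans (leq_addr (cnt P (j * D)) _) _.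
  rewrite (cnt_shift P) addnC -cnt_shift addnC -[leqRHS]addn0 leq_add2l leqn0 /cnt big1 // => x _.
  by rewrite /P; case Fx: (F _) => //; have := FN _ Fx; lia.
rewrite [leqRHS]mulSn [leqRHS]addnC; apply: leq_trans (leq_add IH (leq_trans step Fg)).
apply: leq_trans (cnt_orb _ _ _); apply: cnt_le => x _.
by rewrite mulSn (addnC D) addnA; case: (F x) => //=; case: (F (x + j * D)).
Qed.

(* Averaging over the progressions of length [l] and difference [D] that start
   outside [F]; those starting inside [F] rarely leave it. *)
Lemma progression_average A F N D g l h :
  (forall x, F x -> x < N) -> (forall x, A x -> ~~ F x) ->
  cnt (fun y => F y && ~~ F (y + D)) N <= g ->
  (forall y, cnt (fun j => A (y + j * D)) l <= h) ->
  l * cnt A N + h * cnt F N <= h * N + l * l * g + l * l * D.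
Proof.
move=> FN AF Fg Ah.
(* Fix the j-th term of the progressions. Shifting [A] by jD loses at most lD points. A start y in F
   with y + jD in [A] has drifted out of F, which happens for at most lg points. *)
have fiber j : j < l -> cnt A N <= l * D + l * g + cnt (fun y => ~~ F y && A (y + j * D)) N.
  move=> jl; have le1 : cnt A N <= j * D + cnt (fun y => A (y + j * D)) N.
    apply: (@leq_trans (cnt A (j * D + N))); first by apply: cnt_mono; lia.
    by rewrite -cnt_shift addnC leq_add2r cnt_leN.
  rewrite (cnt_split (fun y => A (y + j * D)) F) in le1.
  have le2 : cnt (fun y => F y && A (y + j * D)) N <= j * g.
    apply: leq_trans (cnt_drift j FN Fg); apply: cnt_le => x _ /andP[-> /AF ->] //.
  have le3 : j * D <= l * D by rewrite leq_mul2r ltnW ?orbT.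
  have le4 : j * g <= l * g by rewrite leq_mul2r ltnW ?orbT.
  lia.
have sum1 : l * cnt A N <= l * (l * D + l * g) +
    \sum_(0 <= j < l) cnt (fun y => ~~ F y && A (y + j * D)) N.
  move: (l * D + l * g) fiber => e fiber.
  rewrite -{1 2}(subn0 l) -!sum_nat_const_nat -big_split /=.
  by rewrite big_nat [leqRHS]big_nat; apply: leq_sum => j /andP[_]; apply: fiber.
have sum2 : \sum_(0 <= j < l) cnt (fun y => ~~ F y && A (y + j * D)) N <= h * cnt (fun y => ~~ F y) N.
  rewrite /cnt exchange_big big_distrr /=; apply: leq_sum => y _.
  case: (F y) => /=; last by rewrite muln1; exact: Ah.
  by rewrite muln0 big1.
have part : cnt F N + cnt (fun y => ~~ F y) N = N.
  rewrite /cnt -big_split /= (eq_bigr (fun=> 1)) => [|y _]; last by case: (F y).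
  by rewrite sum_nat_const_nat muln1 subn0.
have : h * cnt F N + h * cnt (fun y => ~~ F y) N = h * N by rewrite -mulnDr part.
rewrite !mulnDr !mulnA in sum1; lia.
Qed.

Lemma ap_free_affine A a d : 0 < d -> ap_free A -> ap_free (fun i => A (a + i * d)).
Proof.
move=> d0 fA x e e0 Ax Axe Axee; apply: (fA _ (e * d)) Ax _ _; first by rewrite muln_gt0 e0.
  by rewrite -addnA -mulnDl.
by rewrite mulnA -addnA -mulnDl.
Qed.

Lemma ap_free_shift A a : ap_free A -> ap_free (fun i => A (a + i)).
Proof.
move=> fA x e e0 Ax Axe Axee; apply: (fA _ e e0 Ax); first by rewrite -addnA.
by rewrite -addnA.
Qed.

Lemma cnt_blocks l h : (forall A, ap_free A -> cnt A l <= h) ->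
  forall A m, ap_free A -> cnt A (l * m) <= h * m.
Proof.
move=> lh A m fA; elim: m => [|m IH]; first by rewrite muln0 cnt0.
rewrite mulnS addnC -cnt_shift mulnS; apply: leq_add IH; apply: lh.
have := @ap_free_shift A (l * m) fA; rewrite /ap_free => H x d d0.
by rewrite ![_ + l * m]addnC; apply: H.
Qed.

Lemma cube_shift A n ds a : cube (fun y => A (n + y)) ds a = cube A ds (n + a).
Proof. by elim: ds a => //= d ds IH a; rewrite !IH addnA. Qed.

Lemma ap_free_density_gain k q : 0 < q -> exists D n0, forall A n l h g,
  ap_free A -> (forall B, ap_free B -> cnt B l <= h) -> n0 <= n ->
  n <= q * cnt (fun y => A (n + y)) n -> 4 * n < g * k ->
  l * cnt A (4 * n) + h * cnt A n <= h * (4 * n) + l * l * g + l * l * (2 * D).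
Proof.
move=> q0; have [D [n0 cubes]] := hilbert_cube k q0; exists D, n0 => A n l h g fA lh n0n dens gk.
have dens' : n <= q * cnt (fun y => (y < n) && A (n + y)) n.
  by apply: leq_trans dens _; rewrite leq_mul2l cnt_le ?orbT // => x ->.
have [ds [a [sz dsD an cub]]] := cubes _ _ n0n dens'.
(* With centres m in [n, 2n) and x < n, the points x, m, 2m - x form a progression with positive
   difference below 4n. *)
pose B y := (n <= y < 2 * n) && A y.
have cubB : cube B ds (n + a).
  rewrite -cube_shift (@eq_cube _ (fun y => (y < n) && A (n + y))) // => y.
  by rewrite /B; congr (_ && _); lia.
rewrite -sz in gk; have [d [ds' [dds cds' slow]]] := slow_growth A n (n + a) gk.
have /andP[d0 dD] := allP dsD _ dds; have /andP[cubB' _] := cds' _ cubB.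
set F := mirror A n ds' (n + a).
have FP y : F y -> exists x m, [/\ x < n, A x, n <= m < 2 * n, A m & x + y = 2 * m].
  by move=> /(mirrorP cubB')[x [m [xn Ax /andP[mn Am] xy]]]; exists x, m.
have FN y : F y -> y < 4 * n by move=> /FP[x [m [? _ ? _ ?]]]; lia.
have AF y : A y -> ~~ F y.
  move=> Ay; apply/negP => /FP[x [m [xn Ax mn Am xy]]].
  apply: (fA x (m - x) _ Ax); first by lia.
    by rewrite (_ : x + (m - x) = m) //; lia.
  by rewrite (_ : x + 2 * (m - x) = y) //; lia.
(* Both F and F + 2d lie in F', so the points of F that escape inject into F' minus F, which has
   fewer than g elements. *)
have escape : cnt (fun y => F y && ~~ F (y + 2 * d)) (4 * n) <= g.
  set F' := mirror A n (d :: ds') (n + a) in slow.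
  have FF' y : F y -> F' y /\ F' (y + 2 * d).
    by rewrite /F' /= mirror_shift -/F => ->; rewrite orbT.
  have F'N y : F' y -> y < 4 * n.
    by move=> /(mirrorP (cds' _ cubB))[x [m [? _ /andP[? _] ?]]]; lia.
  pose P y := F' y && ~~ F y.
  have le1 : cnt (fun y => F y && ~~ F (y + 2 * d)) (4 * n) <= cnt P (4 * n).
    apply: (@leq_trans (cnt (fun y => P (y + 2 * d)) (4 * n))).
      by apply: cnt_le => y _ /andP[/FF'[_ ?] ?]; rewrite /P; apply/andP.
    apply: leq_trans (leq_addr (cnt P (2 * d)) _) _.
    rewrite cnt_shift addnC -cnt_shift addnC -[leqRHS]addn0 leq_add2l leqn0 /cnt big1 // => x _.
    by rewrite /P; case Fx: (F' _) => //; have := F'N _ Fx; lia.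
  have := cnt_split F' F (4 * n).
  have -> : cnt (fun y => F y && F' y) (4 * n) = cnt F (4 * n).
    by apply: eq_bigr => y _; case Fy: (F y) => //=; have [-> _] := FF' _ Fy.
  have -> : cnt (fun y => ~~ F y && F' y) (4 * n) = cnt P (4 * n).
    by apply: eq_bigr => y _; rewrite /P andbC.
  move: le1 slow; rewrite -/F; lia.
have fib y : cnt (fun j => A (y + j * (2 * d))) l <= h.
  by apply/lh/ap_free_affine => //; lia.
have main := progression_average FN AF escape fib.
have big : cnt A n <= cnt F (4 * n) by apply: cnt_mirror; lia.
have le1 : h * cnt A n <= h * cnt F (4 * n) by rewrite leq_mul2l big orbT.
have le2 : l * l * (2 * d) <= l * l * (2 * D) by rewrite !leq_mul2l dD !orbT.
lia.
Qed.

(** * Lowering a density bound *)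

Local Open Scope R_scope.

Lemma INR_addn m n : INR (m + n)%N = INR m + INR n. Proof. exact: plus_INR. Qed.
Lemma INR_muln m n : INR (m * n)%N = INR m * INR n. Proof. exact: mult_INR. Qed.
Lemma INR_leq m n : (m <= n)%N -> INR m <= INR n.
Proof. by move/leP; apply: le_INR. Qed.
Lemma INR_expn m n : INR (m ^ n)%N = INR m ^ n.
Proof. by elim: n => [|n IH] //; rewrite expnS INR_muln IH. Qed.

Lemma nat_floor x : 0 <= x -> exists n, INR n <= x < INR n + 1.
Proof.
move=> x0; have [up1 up2] := archimed x.
have upos : (0 < up x)%Z by apply: lt_IZR; lra.
exists (Z.to_nat (up x - 1)); rewrite INR_IZR_INZ Z2Nat.id; last by lia.
by rewrite minus_IZR; lra.
Qed.

Lemma nat_multiple_above a b : 0 < b -> exists n, (0 < n)%N /\ a <= INR n * b.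
Proof.
move=> b0; have [n [_ nx]] := nat_floor (Rmax_l 0 (a / b)); exists n.+1; split=> //.
rewrite S_INR; have := Rmax_r 0 (a / b) => le.
have -> : a = a / b * b by field; lra.
by apply: Rmult_le_compat_r; lra.
Qed.

(** A single length l is enough: cutting into blocks carries the bound to every multiple of l. *)
Definition density_bound (c : R) :=
  exists l, (0 < l)%N /\ forall A, ap_free A -> INR (cnt A l) <= c * INR l.

Lemma density_bound_le c c' : c <= c' -> density_bound c -> density_bound c'.
Proof.
move=> cc' [l [l0 H]]; exists l; split=> // A fA; apply: Rle_trans (H _ fA) _.
by apply: Rmult_le_compat_r => //; apply: pos_INR.
Qed.

Lemma density_bound_nat c : 0 <= c -> density_bound c -> exists l h,
  [/\ (0 < l)%N, INR h <= c * INR l & forall A, ap_free A -> (cnt A l <= h)%N].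
Proof.
move=> c0 [l [l0 H]].
have [h [h1 h2]] := nat_floor (Rmult_le_pos _ _ c0 (pos_INR l)).
exists l, h; split=> // A /H le; rewrite -ltnS; apply/ltP/INR_lt; rewrite S_INR; lra.
Qed.

(** Let e = c^2/64 and suppose that c + e is a bound but c - e is not. Then some progression-free
    set has more than 4n(c - e) points below 4n, hence at least cn/2 in each of the first two
    quarters. The gain inequality now bounds it by 4n(c + e) - n c^2/2 + 3n c^2/8 = 4n(c - e), a
    contradiction. *)
Lemma density_bound_gain c : 0 < c <= 1 ->
  density_bound (c + c * c / 64) -> density_bound (c - c * c / 64).
Proof.
move=> [c0 c1] bnd; apply: NNPP => nbnd; set e := c * c / 64 in bnd nbnd.
have e0 : 0 < e by rewrite /e; nra.
have ec : 64 * e <= c by rewrite /e; nra.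
have [l [h [l0 hl lh]]] := density_bound_nat (Rlt_le _ _ (Rplus_lt_0_compat _ _ c0 e0)) bnd.
have l0R : 0 < INR l by apply: lt_0_INR; apply/ltP.
have cc0 : 0 < c * c by nra.
(* The integer k makes lg at most n c^2/8 up to rounding, q turns density c/2 into at least 1/q, and
   [m1] makes the remaining errors l + 2lD at most n c^2/4. *)
have [k [k0 kc]] := nat_multiple_above (INR l * 32) cc0.
have [q [q0 qc]] := nat_multiple_above 2 c0.
have [D [n0 gain]] := ap_free_density_gain k q0.
have [m1 [m10 mc]] := nat_multiple_above (4 * (INR l + 2 * INR l * INR D)) cc0.
set m := (n0 + m1)%N; have nm : (n0 <= m)%N by rewrite leq_addr.
have {}mc : 4 * (INR l + 2 * INR l * INR D) <= INR m * (c * c).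
  by apply: Rle_trans mc _; rewrite INR_addn; have := pos_INR n0; nra.
set n := (l * m)%N.
have nE : INR n = INR l * INR m by rewrite INR_muln.
have mn : (m <= n)%N by rewrite leq_pmull.
have {}mc : 4 * (INR l + 2 * INR l * INR D) <= INR n * (c * c).
  by apply: Rle_trans mc _; apply: Rmult_le_compat_r (INR_leq mn); lra.
have n4 : (0 < 4 * n)%N by rewrite /n !muln_gt0 l0 addn_gt0 m10 orbT.
have [A [fA big]] : exists A, ap_free A /\ (c - e) * INR (4 * n) < INR (cnt A (4 * n)).
  apply: NNPP => none; apply: nbnd; exists (4 * n)%N; split=> // A fA.
  by apply: Rnot_lt_le => lt; apply: none; exists A.
rewrite INR_muln (_ : INR 4 = 4) in big; last by rewrite /=; lra.
have blocks j B : ap_free B -> INR (cnt B (j * n)) <= (c + e) * (INR j * INR n).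
  move=> fB; apply: (Rle_trans _ (INR (h * (j * m)))).
    by apply: INR_leq; rewrite /n mulnCA; apply: cnt_blocks.
  rewrite nE !INR_muln; have := Rmult_le_compat_r (INR j * INR m) _ _ _ hl.
  by move/(_ (Rmult_le_pos _ _ (pos_INR j) (pos_INR m))); lra.
clearbody n; clear nE.
have fA' j : ap_free (fun y => A (y + j)%N).
  by move=> x d d0; rewrite !(addnAC _ _ j); apply: fA.
(* The other three quarters hold at most 3n(c + e) points, which leaves n(c - 7e) >= cn/2. *)
have left : c / 2 * INR n <= INR (cnt A n).
  have := blocks 3%N _ (fA' n); have := cnt_shift A n (3 * n)%N.
  move=> /(f_equal INR); rewrite INR_addn (_ : (n + 3 * n = 4 * n)%N); last by lia.
  have -> : INR 3 = 3 by rewrite /=; lra.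
  have := pos_INR n; nra.
have mid : c / 2 * INR n <= INR (cnt (fun y => A (n + y)%N) n).
  have := blocks 2%N _ (fA' (2 * n)%N); have := cnt_shift A (2 * n)%N (2 * n)%N.
  move=> /(f_equal INR); rewrite INR_addn (_ : (2 * n + 2 * n = 4 * n)%N); last by lia.
  have := cnt_shift A n n; have := blocks 1%N _ fA; rewrite mul1n.
  move=> b1 /(f_equal INR); rewrite INR_addn addnn -mul2n.
  have -> : cnt (fun x => A (x + n)%N) n = cnt (fun y => A (n + y)%N) n.
    by apply: eq_bigr => y _; rewrite addnC.
  have -> : INR 2 = 2 by rewrite /=; lra.
  rewrite /= in b1; have := pos_INR n; nra.
have n0n := leq_trans nm mn.
have midq : (n <= q * cnt (fun y => A (n + y)) n)%N.
  apply/leP/INR_le; rewrite INR_muln.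
  by have := pos_INR n; have := pos_INR q; nra.
have gk : (4 * n < (4 * n %/ k).+1 * k)%N by apply: ltn_ceil.
have := INR_leq (gain _ _ _ _ _ fA lh n0n midq gk).
rewrite !(INR_addn, INR_muln) (S_INR (_ %/ _)).
have gR : INR (4 * n %/ k) * INR k <= 4 * INR n.
  rewrite -INR_muln; have -> : 4 = INR 4 by rewrite /=; lra.
  by rewrite -INR_muln; apply: INR_leq; apply: leq_trunc_div.
have -> : INR 4 = 4 by rewrite /=; lra.
have -> : INR 2 = 2 by rewrite /=; lra.
have an : INR (cnt A n) <= INR n by apply/INR_leq/cnt_leN.
move: (INR (4 * n %/ k)) (pos_INR (4 * n %/ k)) gR => g g0 gR.
move: (INR (cnt A (4 * n))) (INR (cnt A n)) big left an => a4 a1 big left an.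
move: (INR n) (INR l) (INR h) (INR k) (INR D) (pos_INR n) l0R kc mc left an big hl gR.
clear -c0 c1 e0 ec g0 => {}n {}l {}h {}k {}D n0 l0 kc mc left an big hl gR main.
have h1 : h * (4 * n - a1) <= (c + e) * l * (4 * n - a1).
  by apply: Rmult_le_compat_r hl; lra.
have h2 : a4 <= (c + e) * (4 * n - a1) + l * (g + 1) + l * (2 * D).
  by apply: (Rmult_le_reg_l l) => //; lra.
have h3 : (c + e) * (4 * n - a1) <= (c + e) * (4 * n - c / 2 * n).
  by apply: Rmult_le_compat_l; lra.
have h4 : l * g <= n * (c * c) / 8.
  have : g * (l * 32) <= g * (k * (c * c)) by apply: Rmult_le_compat_l.
  have : g * k * (c * c) <= 4 * n * (c * c) by apply: Rmult_le_compat_r => //; nra.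
  lra.
have h5 : 0 <= n * (e * c) by apply: Rmult_le_pos => //; nra.
have eE : n * e = n * (c * c) / 64 by rewrite /e; field.
lra.
Qed.

(* The infimum of the valid density bounds cannot be positive, since a positive
   one could be lowered. *)
Theorem roth c : 0 < c -> density_bound c.
Proof.
move=> c0; apply: NNPP => nc.
have one : density_bound 1.
  exists 1%N; split=> // A _; rewrite Rmult_1_l; exact/INR_leq/cnt_leN.
pose E x := ~ density_bound x.
have E1 : bound E.
  exists 1 => x Ex; apply: Rnot_lt_le => x1; apply: Ex; apply: density_bound_le one; lra.
have [s [ub lub]] := completeness E E1 (ex_intro _ c nc).
have cs := ub c nc.
have s1 : s <= 1.
  by apply: lub => x Ex; apply: Rnot_lt_le => x1; apply: Ex; apply: density_bound_le one; lra.
have ss : 0 < s * s by nra.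
have above : density_bound (s + s * s / 64).
  by apply: NNPP => /ub; lra.
have below := density_bound_gain (conj (Rlt_le_trans _ _ _ c0 cs) s1) above.
have : s <= s - s * s / 64.
  apply: lub => x Ex; apply: Rnot_lt_le => lt; apply: Ex.
  by apply: density_bound_le below; lra.
lra.
Qed.

Lemma cnt_ap_free_le c : 0 < c -> exists l, forall A n, ap_free A ->
  INR (cnt A n) <= c * INR n + INR l.
Proof.
move=> c0; have [l [h [l0 hl lh]]] := density_bound_nat (Rlt_le _ _ c0) (roth c0).
exists l => A n fA.
have le1 : (cnt A n <= h * (n %/ l) + l)%N.
  apply: (@leq_trans (cnt A (l * (n %/ l) + l))).
    by apply: cnt_mono; rewrite {1}(divn_eq n l) mulnC leq_add2l ltnW // ltn_mod.
  rewrite -cnt_shift addnC; apply: leq_add; [exact: cnt_blocks|exact: cnt_leN].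
apply: Rle_trans (INR_leq le1) _; rewrite INR_addn INR_muln.
apply: Rplus_le_compat_r; apply: (Rle_trans _ (c * INR l * INR (n %/ l))).
  by apply: Rmult_le_compat_r hl; apply: pos_INR.
rewrite Rmult_assoc; apply: Rmult_le_compat_l; first lra.
by rewrite -INR_muln; apply: INR_leq; rewrite mulnC leq_trunc_div.
Qed.

(** * Counting progression-free words *)

(** Expand (1 + M)^n over subsets S, with a factor M for each absent element: a set of at most s
    elements contributes at least M^(n - s). *)
Lemma card_small_sets n s M : (0 < M)%N ->
  (#|[set S : {set 'I_n} | #|S| <= s]| * M ^ n <= M.+1 ^ n * M ^ s)%N.
Proof.
move=> M0.
have -> : (M.+1 ^ n = \sum_(S : {set 'I_n}) M ^ (n - #|S|))%N.
  have -> : (M.+1 ^ n = \prod_(i < n) (1 + M))%N by rewrite prod_nat_const card_ord add1n.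
  rewrite (bigA_distr _ _ (fun=> 1%N) (fun=> M)); apply: eq_bigr => S _; rewrite big_if /= big1 // mul1n prod_nat_const.
  have -> : #|[pred i | i \notin S]| = #|~: S| by apply: eq_card => i; rewrite !inE.
  by rewrite -[X in (X - _)%N]card_ord -(cardsC S) addKn.
rewrite -sum1dep_card !big_distrl /= [leqRHS](bigID (fun S : {set 'I_n} => #|S| <= s)%N) /=.
apply: leq_trans (leq_addr _ _); apply: leq_sum => S Ss.
by rewrite mul1n -expnD leq_pexp2l //; lia.
Qed.

Lemma exp_le_exp x y : x <= y -> exp x <= exp y.
Proof. by case=> [lt|->]; [apply/Rlt_le/exp_increasing|right]. Qed.

Lemma exp_mul_INR x n : exp x ^ n = exp (x * INR n).
Proof.
elim: n => [|n IH]; first by rewrite Rmult_0_r exp_0.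
by rewrite S_INR Rmult_plus_distr_l Rmult_1_r exp_plus -IH /= Rmult_comm.
Qed.

Lemma cnt_card A n (S : {set 'I_n}) : (forall i : 'I_n, (i \in S) = A i) -> cnt A n = #|S|.
Proof.
move=> SA; rewrite /cnt big_mkord -sum1_card [RHS]big_mkcond /=.
by apply: eq_bigr => i _; rewrite SA; case: (A i).
Qed.

Lemma card_ap_free_words eps : 0 < eps -> exists C, 0 < C /\ forall n (X : {set {set 'I_n}}),
  (forall S, S \in X -> exists A, ap_free A /\ forall i : 'I_n, (i \in S) = A i) ->
  INR #|X| <= C * exp (eps * INR n).
Proof.
(* The choice M >= 2/eps makes (1 + 1/M)^n at most exp(eps n/2). The density c satisfies c ln(M + 1)
   = eps/2, so (M + 1)^s with s <= cn + l costs the other half and the constant. Unlike ln M, ln(M +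
   1) is positive also for M = 1. *)
move=> e0; have [M [M0 Me]] := nat_multiple_above 2 e0.
have [M2 ML] : INR M <> 0 /\ 0 < ln (INR M.+1).
  have M0R : 0 < INR M by apply/lt_0_INR/ltP.
  by split; [lra|rewrite -ln_1; apply: ln_increasing; rewrite ?S_INR; lra].
have [l small] := cnt_ap_free_le (Rmult_lt_0_compat _ _ (Rdiv_pos_pos _ _ e0 Rlt_0_2) (Rinv_0_lt_compat _ ML)).
exists (exp (INR l * ln (INR M.+1))); split; first exact: exp_pos.
set L := ln _ in ML small *; set c := eps / 2 * / L in small *.
have cL : c * L = eps / 2 by rewrite /c; field; lra.
have eL : exp L = INR M.+1 by rewrite /L exp_ln //; apply/lt_0_INR/ltP.
move=> n X XA; have c0 : 0 <= c * INR n + INR l.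
  have := pos_INR n; have := pos_INR l; have : 0 <= c; last by nra.
  by apply: Rlt_le; apply: Rmult_lt_0_compat; [lra|apply: Rinv_0_lt_compat].
have [s [s1 s2]] := nat_floor c0.
have M0R : 0 < INR M by apply/lt_0_INR/ltP.
have Mn0 : 0 < INR M ^ n by apply: pow_lt.
have le1 : (#|X| * M ^ n <= M.+1 ^ n * M.+1 ^ s)%N.
  apply: (leq_trans (leq_mul (subset_leq_card (_ : X \subset [set S : {set 'I_n} | #|S| <= s]%N)) (leqnn _))).
    apply/subsetP => S /XA[A [fA SA]]; rewrite inE -ltnS -(cnt_card SA).
    by apply/ltP/INR_lt; rewrite S_INR; have := small A n fA; lra.
  apply: leq_trans (card_small_sets n s M0) _; rewrite leq_mul2l; apply/orP; right.
  by have [->|s0] := posnP s; rewrite ?expn0 ?leq_exp2r ?leqnSn.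
have := INR_leq le1; rewrite !INR_muln !INR_expn => le2.
have le3 : INR M.+1 ^ n <= INR M ^ n * exp (eps / 2 * INR n).
  rewrite -exp_mul_INR -Rpow_mult_distr; apply: pow_incr.
  rewrite S_INR; split; first lra.
  have := exp_ineq1_le (eps / 2); nra.
have le4 : INR M.+1 ^ s <= exp (INR l * L + eps / 2 * INR n).
  rewrite -eL exp_mul_INR; apply: exp_le_exp; rewrite -cL.
  by have := Rmult_le_compat_l L _ _ (Rlt_le _ _ ML) s1; lra.
apply: (Rmult_le_reg_r (INR M ^ n)) => //; apply: Rle_trans le2 _.
have -> : exp (INR l * L) * exp (eps * INR n) * INR M ^ n =
  INR M ^ n * exp (eps / 2 * INR n) * exp (INR l * L + eps / 2 * INR n).
  have -> : eps * INR n = eps / 2 * INR n + eps / 2 * INR n by field.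
  by rewrite !exp_plus; ring.
by apply: Rmult_le_compat => //; apply: pow_le; apply: pos_INR.
Qed.

(** This turns a count of words into a count of indices. The family [w] is arbitrary, so that digit
    words may start at a position depending on k. *)
Lemma distinct_ap_free_words eps : 0 < eps -> exists C, 0 < C /\
  forall n m q P (w : nat -> nat -> bool),
  (forall k, (m <= k < m + q)%N -> P k -> ap_free (w k)) ->
  (forall k k', (m <= k < m + q)%N -> (m <= k' < m + q)%N -> P k -> P k' ->
     (forall i, (i < n)%N -> w k i = w k' i) -> k = k') ->
  INR (\sum_(m <= k < m + q) P k) <= C * exp (eps * INR n).
Proof.
move=> /card_ap_free_words[C [C0 H]]; exists C; split=> // n m q P w fw inj.
pose K := [set k : 'I_q | P (m + k)%N].
pose word (k : 'I_q) := [set i : 'I_n | w (m + k)%N i].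
have inq (k : 'I_q) : (m <= m + k < m + q)%N by rewrite leq_addr ltn_add2l ltn_ord.
have -> : (\sum_(m <= k < m + q) P k = #|word @: K|)%N.
  rewrite card_in_imset => [|k k']; last first.
    rewrite !inE => Pk Pk' /setP eqw; apply: val_inj; apply: (@addnI m).
    apply: inj (inq k) (inq k') Pk Pk' _ => i ni; by have := eqw (Ordinal ni); rewrite !inE.
  rewrite -{1}(add0n m) big_addn addKn big_mkord -sum1_card [RHS]big_mkcond /=.
  by apply: eq_bigr => k _; rewrite inE addnC; case: (P _).
apply: H => S /imsetP[k]; rewrite inE => Pk ->; exists (w (m + k)%N); split; first exact: fw.
by move=> i; rewrite inE.
Qed.

(** * Diophantine approximation *)

Lemma floorZ_bounds x : IZR (floorZ x) <= x < IZR (floorZ x) + 1.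
Proof. by have [h1 h2] := base_Int_part x; rewrite /floorZ; lra. Qed.

Lemma irrational_IZR x p : irrational x -> x <> IZR p.
Proof. by move=> ix e; apply: (ix (Qmake p 1)); rewrite e /Q2R /=; field. Qed.

Lemma Q2R_quotient (p q : Z) : q <> 0%Z -> exists r : Q, Q2R r = IZR p / IZR q.
Proof.
move=> q0; have q0R : IZR q <> 0 by apply: not_0_IZR.
have [qp|qn] : (0 < q \/ q < 0)%Z by lia.
  by exists (Qmake p (Z.to_pos q)); rewrite /Q2R /= Z2Pos.id.
exists (Qmake (- p) (Z.to_pos (- q))); rewrite /Q2R /= Z2Pos.id; last by lia.
by rewrite !opp_IZR; field.
Qed.

Lemma irrational_linear x p q : irrational x -> q <> 0%Z -> IZR q * x <> IZR p.
Proof.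
move=> ix q0 e; have [r rE] := Q2R_quotient p q0; apply: (ix r); rewrite rE -e.
by field; apply: not_0_IZR.
Qed.

Lemma irrational_cf_step x a : irrational x -> irrational (/ (x - IZR a)).
Proof.
move=> ix r e; have xa : x - IZR a <> 0 by have := @irrational_IZR x a ix; lra.
have r0 : Qnum r <> 0%Z.
  move=> n0; have : / (x - IZR a) <> 0 by apply: Rinv_neq_0_compat.
  by rewrite e /Q2R n0; lra.
have d0 : IZR (Zpos (Qden r)) <> 0 by apply: not_0_IZR.
have r0R := not_0_IZR _ r0.
apply: (@irrational_linear x (Zpos (Qden r) + a * Qnum r) (Qnum r) ix r0).
have : x - IZR a = IZR (Zpos (Qden r)) / IZR (Qnum r).
  by rewrite -(Rinv_inv (x - IZR a)) e /Q2R; field.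
rewrite plus_IZR mult_IZR => h; have -> : x = IZR (Zpos (Qden r)) / IZR (Qnum r) + IZR a by lra.
by field.
Qed.

Lemma irrational_cf_rem x n : irrational x -> irrational (cf_rem x n).
Proof. by move=> ix; elim: n => //= n IH; apply: irrational_cf_step. Qed.

Lemma cf_rem_step x n : irrational x -> 1 < cf_rem x n.+1 /\
  cf_rem x n = IZR (partial_quotient x n) + / cf_rem x n.+1.
Proof.
move=> ix; have iy := @irrational_cf_rem x n ix.
rewrite /= /partial_quotient; move: (cf_rem x n) iy => y iy.
have [f1 f2] := floorZ_bounds y; have := @irrational_IZR y (floorZ y) iy => ne.
rewrite Rinv_inv; split; last by lra.
by rewrite -[1]Rinv_1; apply: Rinv_lt_contravar; lra.
Qed.

(* [|q x - p| (p + lam q) / (x + lam)] is unchanged by [x = a + 1/x'],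
   [(p, q) = (a p' + q', p')], [lam' = 1/(a + lam)], a step that decreases [p + q]. *)
Lemma cf_form_lower (x : nat -> R) (a : nat -> Z) K :
  (forall n, 1 < x n <= K) -> (forall n, x n = IZR (a n) + / x n.+1) ->
  forall (s n : nat) (p q : Z) lam, 0 <= lam <= 1 -> (1 <= p)%Z -> (0 <= q)%Z ->
  (p + q <= Z.of_nat s)%Z ->
  x n + lam <= (K + 1) * (Rabs (IZR q * x n - IZR p) * (IZR p + lam * IZR q)).
Proof.
move=> xK xE; elim=> [|s IH] n p q lam lam01 p1 q0 pqs; first by lia.
have [xn1 xnK] := xK n; have [xm1 xmK] := xK n.+1.
have xm0 : 0 < / x n.+1 < 1.
  by split; [apply: Rinv_0_lt_compat; lra|rewrite -[1]Rinv_1; apply: Rinv_lt_contravar; lra].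
have a1 : (1 <= a n)%Z by have := xE n => e; have : (0 < a n)%Z by [apply: lt_IZR; lra]; lia.
have p1R := IZR_le _ _ p1; have q0R := IZR_le _ _ q0; have a1R := IZR_le _ _ a1.
have w1 : 1 <= IZR p + lam * IZR q by nra.
have trivial_case : 1 <= Rabs (IZR q * x n - IZR p) ->
    x n + lam <= (K + 1) * (Rabs (IZR q * x n - IZR p) * (IZR p + lam * IZR q)).
  move=> h; have : 1 <= Rabs (IZR q * x n - IZR p) * (IZR p + lam * IZR q) by nra.
  by move: (Rabs _ * _) => t; nra.
have [qz|q1] : (q = 0 \/ 1 <= q)%Z by lia.
  by apply: trivial_case; rewrite qz Rmult_0_l Rminus_0_l Rabs_Ropp Rabs_pos_eq; lra.
have q1R := IZR_le _ _ q1.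
(* If p < aq, then qx - p = (aq - p) + q/x' is at least 1. Otherwise p - aq >= 0 and the Euclidean
   step applies. *)
have [small|big] : (p + 1 <= a n * q \/ a n * q <= p)%Z by lia.
  apply: trivial_case; apply: Rle_trans (Rle_abs _).
  by have := IZR_le _ _ small; rewrite plus_IZR mult_IZR (xE n); nra.
have r0 : (0 <= p - a n * q)%Z by lia.
pose lam' := / (IZR (a n) + lam).
have al : 0 < IZR (a n) + lam by lra.
have lam'01 : 0 <= lam' <= 1.
  split; first by apply/Rlt_le/Rinv_0_lt_compat.
  by rewrite -[1]Rinv_1; apply: Rinv_le_contravar; lra.
have := IH n.+1 q (p - a n * q)%Z lam' lam'01 q1 r0 ltac:(nia).
rewrite minus_IZR mult_IZR => le.
have e1 : IZR q * x n - IZR p = - (((IZR p - IZR (a n) * IZR q) * x n.+1 - IZR q) * / x n.+1).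
  by rewrite (xE n); field; lra.
have e2 : IZR p + lam * IZR q = (IZR (a n) + lam) * (IZR q + lam' * (IZR p - IZR (a n) * IZR q)).
  by rewrite /lam'; field; lra.
have e3 : x n + lam = (IZR (a n) + lam) * / x n.+1 * (x n.+1 + lam').
  by rewrite {1}(xE n) /lam'; field; lra.
rewrite e3 e2 e1 Rabs_Ropp Rabs_mult (Rabs_pos_eq (/ _)); last by lra.
have := Rmult_le_compat_l ((IZR (a n) + lam) * / x n.+1) _ _ _ le.
move=> /(_ ltac:(apply: Rmult_le_pos; lra)) h; apply: Rle_trans h _; right; ring.
Qed.

(** Apply [cf_form_lower] with lam = 0 to the complete quotients from the first one on: these exceed
    1 even when x does not. Removing the integer part a of x replaces (p, q) by (q, p - aq). *)
Lemma badly_approximable_lower x : 0 < x -> irrational x -> badly_approximable x ->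
  exists c, 0 < c /\ forall (q : nat) (p : Z), (0 < q)%N ->
    c <= Rabs (INR q * x - IZR p) * INR q.
Proof.
move=> x0 ix [M HM].
have M0 : 0 <= M by apply: Rle_trans (HM 0%N); apply: Rabs_pos.
pose K := M + 1.
pose y n := cf_rem x n.+1.
have yE n : y n = IZR (partial_quotient x n.+1) + / y n.+1 by case: (cf_rem_step n.+1 ix).
have yK n : 1 < y n <= K.
  have [y1 _] := cf_rem_step n ix; split=> //.
  have [f1 f2] := floorZ_bounds (y n); have := HM n.+1; rewrite /partial_quotient -/(y n) => h.
  by have := Rle_trans _ _ _ (Rle_abs _) h; rewrite /K; lra.
exists (/ (K + 1)); split; first by apply: Rinv_0_lt_compat; rewrite /K; lra.
move=> q p q0; have q1R : 1 <= INR q by apply: (INR_leq q0).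
have [y1 x1] := cf_rem_step 0 ix; rewrite -/(y 0%N) [cf_rem x 0]/= in y1 x1.
have [y01 y0K] := yK 0%N; set a := partial_quotient x 0 in x1.
have iy : 0 < / y 0%N by apply: Rinv_0_lt_compat; lra.
have iK : 0 < / (K + 1) by apply: Rinv_0_lt_compat; lra.
have iKy : / (K + 1) <= / y 0%N by apply: Rinv_le_contravar; lra.
pose r := (p - a * Z.of_nat q)%Z.
have e : INR q * x - IZR p = INR q * / y 0%N - IZR r.
  by rewrite /r minus_IZR mult_IZR -INR_IZR_INZ {1}x1; ring.
have [rn|rp] : (r <= 0 \/ 1 <= r)%Z by lia.
  have rnR := IZR_le _ _ rn; apply: (Rle_trans _ (Rabs (INR q * x - IZR p))).
    by apply: Rle_trans (Rle_abs _); rewrite e; nra.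
  by have := Rabs_pos (INR q * x - IZR p); nra.
have := @cf_form_lower y (fun n => partial_quotient x n.+1) K yK yE
  (Z.to_nat (Z.of_nat q + r)) 0%N (Z.of_nat q) r 0 ltac:(lra) ltac:(lia) ltac:(lia) ltac:(lia).
rewrite -INR_IZR_INZ Rmult_0_l !Rplus_0_r => h.
have -> : INR q * x - IZR p = - ((IZR r * y 0%N - INR q) * / y 0%N).
  by rewrite e; field; lra.
rewrite Rabs_Ropp Rabs_mult (Rabs_pos_eq (/ _)); last by lra.
move: (Rabs _) h => t h.
apply: (Rmult_le_reg_l (K + 1)); first by lra.
rewrite Rinv_r; last by lra.
have -> : (K + 1) * (t * / y 0%N * INR q) = (K + 1) * (t * INR q) * / y 0%N by ring.
by have := Rmult_le_compat_r (/ y 0%N) _ _ (Rlt_le _ _ iy) h; rewrite Rinv_r; lra.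
Qed.

Definition separated x c q :=
  forall j p, (0 < j < q)%N -> c <= Rabs (INR j * x - IZR p) * INR q.

Lemma nearest_integer x : exists p, forall p', Rabs (x - IZR p) <= Rabs (x - IZR p').
Proof.
have [f1 f2] := floorZ_bounds x; move: (floorZ x) f1 f2 => f f1 f2.
have far p' : (p' <= f \/ f + 1 <= p')%Z -> x - IZR f <= Rabs (x - IZR p') \/ IZR f + 1 - x <= Rabs (x - IZR p').
  case=> /IZR_le; rewrite ?plus_IZR => h; [left|right].
    by apply: Rle_trans (Rle_abs _); lra.
  by rewrite Rabs_minus_sym; apply: Rle_trans (Rle_abs _); lra.
have [le|lt] := Rle_lt_dec (x - IZR f) (IZR f + 1 - x); [exists f|exists (f + 1)%Z] => p'.
  by rewrite (Rabs_pos_eq (_ - IZR f)); last lra; case: (far p' ltac:(lia)); lra.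
rewrite plus_IZR (Rabs_minus_sym x (_ + _)) (Rabs_pos_eq (_ - x)); last lra.
by case: (far p' ltac:(lia)); lra.
Qed.

Lemma best_approximation x n : (0 < n)%N -> exists j p, (0 < j <= n)%N /\
  forall j' p', (0 < j' <= n)%N -> Rabs (INR j * x - IZR p) <= Rabs (INR j' * x - IZR p').
Proof.
case: n => // n _; elim: n => [|n [j [p [jn H]]]].
  have [p Hp] := nearest_integer (INR 1 * x); exists 1%N, p; split=> // j' p' j1.
  by have -> : j' = 1%N by lia.
have [p' Hp'] := nearest_integer (INR n.+2 * x).
have [le|lt] := Rle_lt_dec (Rabs (INR j * x - IZR p)) (Rabs (INR n.+2 * x - IZR p')).
  exists j, p; split=> [|i r iN]; first by lia.
  have [iE|iN'] : i = n.+2 \/ (0 < i <= n.+1)%N by lia.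
    by rewrite iE; apply: Rle_trans le (Hp' r).
  exact: H.
exists n.+2, p'; split=> [|i r iN]; first by lia.
have [->//|iN'] : i = n.+2 \/ (0 < i <= n.+1)%N by lia.
by have := H i r iN'; lra.
Qed.

(* Take the first [q] whose multiple is closer to an integer than all the previous
   ones: the two approximations have a nonzero determinant. *)
Lemma irrational_separated x n : irrational x -> exists q, (n < q)%N /\ separated x (/ 2) q.
Proof.
move=> ix; have [j0 [p0 [j0n H]]] := @best_approximation x n.+1 isT.
set dl := Rabs _ in H.
have dl0 : 0 < dl.
  apply: Rabs_pos_lt => e; apply: (@irrational_linear x p0 (Z.of_nat j0) ix); first by lia.
  by rewrite -INR_IZR_INZ; lra.
pose better q := (0 < q)%N /\ exists p, Rabs (INR q * x - IZR p) < dl.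
(* If no q improves on [dl], then [dl] is a uniform lower bound and every q >= 1/(2 dl) is
   separated; handling this case directly avoids Dirichlet's theorem. *)
have [[q1 Hq1]|none] := classic (exists q, better q); last first.
  have [m [m0 mdl]] := nat_multiple_above (/ 2) dl0.
  exists (n + m)%N; split; first by lia.
  move=> j p /andP[j1 _]; have le : dl <= Rabs (INR j * x - IZR p).
    by apply: Rnot_lt_le => lt; apply: none; exists j; split=> //; exists p.
  rewrite INR_addn; have := pos_INR n; have := pos_INR m; move: (Rabs _) le => t le m0R n0R.
  by have := Rmult_le_compat_l _ _ _ m0R le; have := Rmult_le_pos t _ ltac:(lra) n0R; lra.
have [q [[q0 [p Hp]] qmin]] : exists q, better q /\ forall j, (j < q)%N -> ~ better j.
  elim/ltn_ind: q1 Hq1 => q IH Hq.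
  have [[j [jq Hj]]|no] := classic (exists j, (j < q)%N /\ better j); first exact: IH jq Hj.
  by exists q; split=> // j jq Hj; apply: no; exists j.
have nq : (n.+1 < q)%N.
  by rewrite ltnNge; apply/negP => qn; have := H q p; rewrite q0 qn => /(_ isT); lra.
exists q; split; first by lia.
move=> j p' /andP[j1 jq]; have le : dl <= Rabs (INR j * x - IZR p').
  by apply: Rnot_lt_le => lt; apply: (qmin j jq); split=> //; exists p'.
have qR : 0 < INR q by apply/lt_0_INR/ltP.
have j0R : 1 <= INR j0 by apply: (@INR_leq 1); case/andP: j0n.
have j0q : INR j0 < INR q by apply/lt_INR/ltP; lia.
apply: (Rle_trans _ (dl * INR q)); last by apply: Rmult_le_compat_r; lra.
(* If the determinant j0 p - q p0 vanished, then q dl = j0 |qx - p| < q dl. So it is at least 1 in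
   absolute value, whence 1 <= j0 |qx - p| + q dl <= 2 q dl. *)
have [det0|det1] : (Z.of_nat j0 * p = Z.of_nat q * p0 \/
    1 <= Z.abs (Z.of_nat j0 * p - Z.of_nat q * p0))%Z by lia.
  have := f_equal IZR det0; rewrite !mult_IZR -!INR_IZR_INZ => det0R.
  have : INR q * dl = INR j0 * Rabs (INR q * x - IZR p).
    rewrite -(Rabs_pos_eq (INR q)) ?[X in X * _ = _]Rabs_pos_eq; try lra.
    rewrite -[X in _ = X * _]Rabs_pos_eq; last by lra.
    rewrite /dl -{1}(Rabs_pos_eq (INR q)) -?Rabs_mult; try lra.
    by congr Rabs; rewrite Rabs_pos_eq; lra.
  nra.
have := IZR_le _ _ det1; rewrite abs_IZR minus_IZR !mult_IZR -!INR_IZR_INZ => det.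
have : Rabs (INR j0 * IZR p - INR q * IZR p0) <= INR j0 * Rabs (INR q * x - IZR p) + INR q * dl.
  have -> : INR j0 * IZR p - INR q * IZR p0 =
    INR j0 * - (INR q * x - IZR p) + INR q * (INR j0 * x - IZR p0) by ring.
  apply: Rle_trans (Rabs_triang _ _) _.
  by rewrite !Rabs_mult Rabs_Ropp !(Rabs_pos_eq (INR _)); try lra; right.
nra.
Qed.

(** * Binary digits of the powers *)

Lemma pow2_bracket y : 1 < y -> exists n, 2 ^ n < y <= 2 ^ n.+1.
Proof.
move=> y1; have [m ym] : exists m, y <= 2 ^ m.
  have [m [_ my]] := nat_multiple_above y Rlt_0_1; exists m; apply: Rle_trans my _.
  rewrite Rmult_1_r; elim: m => [|m IH]; first by rewrite /=; lra.
  have := pow_R1_Rle 2 m ltac:(lra); rewrite S_INR /=; lra.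
elim: m ym => [|m IH] ym; first by rewrite /= in ym; lra.
by have [/IH|lt] := Rle_lt_dec y (2 ^ m); last exists m.
Qed.

(** For u <= v, the inequality exp t >= 1 + t at t = ln v - ln u gives u(1 + t) <= v, and u >= 1
    yields t <= v - u. *)
Lemma ln_dist_le s t : 1 <= s -> 1 <= t -> Rabs (ln s - ln t) <= Rabs (s - t).
Proof.
have key u v : 1 <= u -> u <= v -> 0 <= ln v - ln u <= v - u.
  move=> u1 uv; have lnuv : ln u <= ln v by case: uv => [lt|->]; [apply/Rlt_le/ln_increasing; lra|right].
  split; first lra.
  have := exp_ineq1_le (ln v - ln u); rewrite exp_plus exp_Ropp !exp_ln; try lra.
  move=> h; have : u * (1 + (ln v - ln u)) <= u * (v * / u) by apply: Rmult_le_compat_l; lra.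
  have -> : u * (v * / u) = v by field; lra.
  nra.
move=> s1 t1; have [st|ts] := Rle_lt_dec s t.
  by have [k1 k2] := key _ _ s1 st; rewrite Rabs_minus_sym (Rabs_minus_sym s) !Rabs_pos_eq; lra.
by have [k1 k2] := key _ _ t1 (Rlt_le _ _ ts); rewrite !Rabs_pos_eq; lra.
Qed.

Lemma floorZ_unique x p : IZR p <= x < IZR p + 1 -> floorZ x = p.
Proof.
have [f1 f2] := floorZ_bounds x; move=> [p1 p2].
have : (floorZ x < p + 1)%Z by apply: lt_IZR; rewrite plus_IZR; lra.
have : (p < floorZ x + 1)%Z by apply: lt_IZR; rewrite plus_IZR; lra.
by lia.
Qed.

Lemma floor_double x : floorZ (2 * x) = (2 * floorZ x + floorZ (2 * x) mod 2)%Z.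
Proof.
have [f1 f2] := floorZ_bounds x; have [g1 g2] := floorZ_bounds (2 * x).
have : (floorZ (2 * x) < 2 * floorZ x + 2)%Z.
  by apply: lt_IZR; rewrite plus_IZR mult_IZR; lra.
have : (2 * floorZ x < floorZ (2 * x) + 1)%Z.
  by apply: lt_IZR; rewrite plus_IZR mult_IZR; lra.
move: (floorZ (2 * x)) (floorZ x) => u v h1 h2.
have := Z.div_mod u 2 ltac:(lia); have := Z.mod_pos_bound u 2 ltac:(lia); lia.
Qed.

(** The digits determine the floors of 2^i s successively. The digit at i = 0 is the integer part 1,
    so n > 0 common digits only give 2^(n-1) |s - t| <= 1. *)
Lemma significand_eq_digits s t n : 1 <= s < 2 -> 1 <= t < 2 ->
  (forall i, (i < n)%N -> (floorZ (2 ^ i * s) mod 2 = floorZ (2 ^ i * t) mod 2)%Z) ->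
  2 ^ n * Rabs (s - t) <= 2.
Proof.
move=> s12 t12 eqd; case: n eqd => [|n] eqd.
  by rewrite /= Rmult_1_l; apply: Rabs_le; lra.
have fl i : (i <= n)%N -> floorZ (2 ^ i * s) = floorZ (2 ^ i * t).
  elim: i => [|i IH] iN.
    by rewrite /= !Rmult_1_l (@floorZ_unique s 1) ?(@floorZ_unique t 1) //; lra.
  have := eqd i.+1 iN; rewrite /= !Rmult_assoc => e.
  by rewrite floor_double (floor_double (2 ^ i * t)) e IH // ltnW.
have := fl n (leqnn n); have [] := floorZ_bounds (2 ^ n * s); have [] := floorZ_bounds (2 ^ n * t).
move=> h1 h2 h3 h4 e; rewrite e in h3 h4.
have : Rabs (2 ^ n * s - 2 ^ n * t) <= 1 by apply: Rabs_le; lra.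
rewrite -Rmult_minus_distr_l Rabs_mult Rabs_pos_eq /=; last by apply: pow_le; lra.
lra.
Qed.

Definition inW beta k : bool :=
  if excluded_middle_informative (W_set beta k) then true else false.

Lemma inWP beta k : inW beta k -> W_set beta k.
Proof. by rewrite /inW; case: excluded_middle_informative. Qed.

Lemma count_upto_sum beta N : count_upto (W_set beta) N = (\sum_(1 <= k < 1 + N) inW beta k)%N.
Proof.
rewrite /count_upto /index_iota addKn; elim: N {-1}1%N => [|N IH] m; first by rewrite big_nil.
by rewrite /= big_cons IH /inW; case: excluded_middle_informative.
Qed.

(** The exponent exists for every k, with conditions only for k > 0, so that a total choice function
    can be extracted. Its positivity keeps all positions e + i in the range of [A_set]. *)
Lemma significand beta k : 1 < beta -> exists e, (0 < k)%N ->
  (0 < e)%N /\ 1 <= 2 ^ e * / beta ^ k < 2.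
Proof.
move=> b1; have [->|k0] := posnP k; first by exists 0%N.
have bk : 1 < beta ^ k by apply: Rlt_pow_R1 => //; apply/ltP.
have [e [e1 e2]] := pow2_bracket bk; exists e.+1 => _; split=> //.
have ib : 0 < / beta ^ k by apply: Rinv_0_lt_compat; lra.
have one : beta ^ k * / beta ^ k = 1 by apply: Rinv_r; lra.
by rewrite -one; split; [|rewrite /=]; nra.
Qed.

Lemma separated_block_count beta c eps : 1 < beta -> 0 < c < 4 -> 0 < eps ->
  exists C, 0 < C /\ forall q m, (0 < q)%N -> (0 < m)%N ->
    separated (ln beta / ln 2) c q ->
    INR (\sum_(m <= k < m + q) inW beta k) <= C * Rpower (INR q) eps.
Proof.
move=> b1 c04 e0; have l2 := ln_lt_2.
have [C [C0 HC]] := distinct_ap_free_words (Rmult_lt_0_compat _ (ln 2) e0 ltac:(lra)).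
exists (C * Rpower (8 / c) eps); split; first by apply: Rmult_lt_0_compat => //; apply: exp_pos.
move=> q m q0 m0 sep; have q1R : 1 <= INR q by apply: (@INR_leq 1).
have c4 : 1 < 4 / c by apply: (Rmult_lt_reg_r c); [|rewrite /Rdiv Rmult_assoc Rinv_l]; lra.
(* Words of length n + 1 are used: 2^(n+1) >= 4q/c separates the indices, and 2^(n+1) < 8q/c bounds
   the number of words by a constant times q^eps. *)
have [n [n1 n2]] := @pow2_bracket (4 / c * INR q) ltac:(nra).
pose ek k := proj1_sig (constructive_indefinite_description _ (significand k b1)).
have ekP k : (0 < k)%N -> (0 < ek k)%N /\ 1 <= 2 ^ ek k * / beta ^ k < 2.
  by rewrite /ek; case: constructive_indefinite_description.
pose w k i := Z.eqb (bin_digit (/ beta ^ k) (ek k + i)) 1.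
have digit k i : (0 < k)%N ->
    bin_digit (/ beta ^ k) (ek k + i) = (floorZ (2 ^ i * (2 ^ ek k * / beta ^ k)) mod 2)%Z.
  (* The separate clause of [bin_digit] at 1 cannot apply, since beta^k > 1. *)
  move=> k0; rewrite /bin_digit; case: Req_EM_T => [e|_].
    have : 1 < beta ^ k by apply: Rlt_pow_R1 => //; apply/ltP.
    by rewrite -(Rinv_inv (beta ^ k)) e; lra.
  by rewrite pow_add; congr (floorZ _ mod 2)%Z; ring.
have le1 : INR (\sum_(m <= k < m + q) inW beta k) <= C * exp (eps * ln 2 * INR n.+1).
  apply: (HC n.+1 m q (inW beta) w) => [k km /inWP Wk a d d0 wa wad wadd|k k' km km' _ _ eqw].
    have k0 : (0 < k)%N by lia.
    have [e1 _] := ekP k k0; apply: Wk; exists (ek k + a)%N, d; split; first by apply/leP.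
    have inA i : w k i -> A_set beta k (ek k + i)%N.
      by move=> /Z.eqb_eq wi; split=> //; apply/leP; lia.
    split; first exact: inA.
    split; first by have := inA _ wad; rewrite addnA.
    by have := inA _ wadd; rewrite addnA.
  have k0 : (0 < k)%N by lia.
  have k0' : (0 < k')%N by lia.
  have [_ sk] := ekP k k0; have [_ sk'] := ekP k' k0'.
  have close : 2 ^ n.+1 * Rabs (2 ^ ek k * / beta ^ k - 2 ^ ek k' * / beta ^ k') <= 2.
    apply: significand_eq_digits => // i iN; have := eqw i iN; rewrite /w -!digit //.
    have db z i' : (0 < z)%N -> (0 <= bin_digit (/ beta ^ z) (ek z + i') < 2)%Z.
      by move=> z0; rewrite digit //; apply: Z.mod_pos_bound.
    have := db k i k0; have := db k' i k0'.
    by move: (bin_digit _ _) (bin_digit _ _) => u v; case: Z.eqb_spec; case: Z.eqb_spec; lia.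
  have lnE z : (0 < z)%N -> ln (2 ^ ek z * / beta ^ z) = INR (ek z) * ln 2 - INR z * ln beta.
    move=> z0; rewrite ln_mult ?ln_Rinv ?ln_pow //; try lra.
    - by apply: pow_lt; lra.
    - by apply: pow_lt; lra.
    - by apply/Rinv_0_lt_compat/pow_lt; lra.
  (* Equal words put the logarithms of the two significands within 2/2^(n+1) <= c/(2q). Their
     difference is (j theta - p) ln 2 with j = k2 - k1 < q, at least c ln 2 / q in absolute value,
     and ln 2 > 1/2. *)
  have gap k1 k2 : (0 < k1)%N -> (k1 < k2)%N -> (k2 - k1 < q)%N ->
      2 ^ n.+1 * Rabs (2 ^ ek k1 * / beta ^ k1 - 2 ^ ek k2 * / beta ^ k2) <= 2 -> False.
    move=> k10 k12 kq close'; have [_ s1] := ekP k1 k10; have [_ s2] := ekP k2 ltac:(lia).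
    have := ln_dist_le (proj1 s1) (proj1 s2); rewrite !lnE; try lia.
    have := sep (k2 - k1)%N (Z.of_nat (ek k2) - Z.of_nat (ek k1))%Z ltac:(lia).
    rewrite minus_IZR -!INR_IZR_INZ minus_INR; last by apply/leP; lia.
    move: (Rabs (2 ^ _ * _ - _)) close' => t close'.
    have -> : INR (ek k1) * ln 2 - INR k1 * ln beta - (INR (ek k2) * ln 2 - INR k2 * ln beta) =
      ((INR k2 - INR k1) * (ln beta / ln 2) - (INR (ek k2) - INR (ek k1))) * ln 2.
      by field; lra.
    rewrite Rabs_mult (Rabs_pos_eq (ln 2)); last lra.
    move: (Rabs _) => u cu ut.
    have pn : 0 < 2 ^ n.+1 by apply: pow_lt; lra.
    have h1 : 2 ^ n.+1 * (u * ln 2) <= 2 by apply: Rle_trans close'; apply: Rmult_le_compat_l; lra.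
    have h2 : 4 * INR q <= c * 2 ^ n.+1.
      have := Rmult_le_compat_l c _ _ ltac:(lra) n2.
      by have -> : c * (4 / c * INR q) = 4 * INR q by field; lra.
    have h3 : c * 2 ^ n.+1 * ln 2 <= 2 * INR q.
      have a1 := Rmult_le_compat_r (2 ^ n.+1 * ln 2) _ _ ltac:(nra) cu.
      by have a2 := Rmult_le_compat_r (INR q) _ _ ltac:(lra) h1; lra.
    have h4 : 4 * INR q * ln 2 <= c * 2 ^ n.+1 * ln 2 by apply: Rmult_le_compat_r; lra.
    nra.
  have [lt|gt|//] := ltngtP k k'.
    by case: (gap k k' k0 lt ltac:(lia) close).
  by rewrite Rabs_minus_sym in close; case: (gap k' k k0' gt ltac:(lia) close).
apply: Rle_trans le1 _; rewrite (Rmult_assoc C); apply: Rmult_le_compat_l; first lra.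
have -> : exp (eps * ln 2 * INR n.+1) = Rpower (2 ^ n.+1) eps.
  by rewrite /Rpower ln_pow; [congr exp; ring|lra].
rewrite Rpower_mult_distr; try (apply: Rdiv_pos_pos; lra); try lra.
apply: Rle_Rpower_l; first lra.
split; first by apply: pow_lt; lra.
by rewrite /= /Rdiv in n1 *; lra.
Qed.

(** * Density and counting bounds from blocks *)

Lemma sum_blocks P q (b : R) t : (forall m, (0 < m)%N -> INR (\sum_(m <= k < m + q) P k) <= b) ->
  INR (\sum_(1 <= k < 1 + q * t) P k) <= b * INR t.
Proof.
move=> H; elim: t => [|t IH]; first by rewrite muln0 big_geq //= Rmult_0_r; right.
rewrite S_INR mulnSr addnA (@big_cat_nat _ _ _ (1 + q * t)) ?leq_addr //=.
by rewrite INR_addn; have := H (1 + q * t)%N isT; lra.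
Qed.

Lemma density_and_count beta : 1 < beta -> irrational (ln beta / ln 2) ->
  Un_cv (fun N => INR (count_upto (W_set beta) N) / INR N) 0 /\
  (badly_approximable (ln beta / ln 2) ->
   forall eps : R, 0 < eps ->
   exists C : R, forall N : nat, (1 <= N)%coq_nat ->
     INR (count_upto (W_set beta) N) <= C * Rpower (INR N) eps).
Proof.
move=> b1 ix; have l2 := ln_lt_2.
have lb : 0 < ln beta by rewrite -ln_1; apply: ln_increasing; lra.
have x0 : 0 < ln beta / ln 2 by apply: Rdiv_pos_pos; lra.
split=> [eta eta0|bad eps e0]; last first.
  have [c [c0 lower]] := badly_approximable_lower x0 ix bad.
  have c'04 : 0 < Rmin c 1 < 4.
    by have := Rmin_r c 1; split; [apply: Rmin_pos|]; lra.
  have [C [C0 HC]] := separated_block_count b1 c'04 e0; exists C => N /leP N1.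
  (* For 0 < j < N the lower bound c/j exceeds c/N, so N itself is a separated scale and [1, N] is a
     single block. *)
  rewrite count_upto_sum; apply: HC => // j p /andP[j0 jN].
  apply: Rle_trans (Rmin_l _ _) (Rle_trans _ _ _ (lower j p j0) _).
  by apply: Rmult_le_compat_l (Rabs_pos _) (INR_leq (ltnW jN)).
have [C [C0 HC]] := @separated_block_count beta (/ 2) (/ 2) b1 ltac:(lra) ltac:(lra).
have eta3 : 0 < eta / 3 by lra.
have [m [m0 mC]] := nat_multiple_above C eta3.
(* With the exponent 1/2 and m >= 3C/eta, any q > m^2 satisfies C sqrt q <= (eta/3) q. *)
have [q [mq sep]] := irrational_separated (m * m) ix.
have q0 : (0 < q)%N by lia.
have qR : 0 < INR q by apply/lt_0_INR/ltP.
have block : C * Rpower (INR q) (/ 2) <= eta / 3 * INR q.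
  rewrite Rpower_sqrt //; have := sqrt_sqrt (INR q) (Rlt_le _ _ qR).
  have ms : INR m <= sqrt (INR q).
    rewrite -(sqrt_square (INR m)); last exact: pos_INR.
    by apply: sqrt_le_1_alt; rewrite -INR_muln; apply: INR_leq; apply: ltnW.
  move: (sqrt _) ms => r ms rr; have := pos_INR m => m0R.
  have h : C <= r * (eta / 3) by apply: Rle_trans mC _; apply: Rmult_le_compat_r; lra.
  by have := Rmult_le_compat_r r _ _ ltac:(lra) h; rewrite -rr; lra.
exists q => N /leP qN; rewrite /Rdist Rminus_0_r.
have NR : 0 < INR N by apply/lt_0_INR/ltP; lia.
rewrite Rabs_pos_eq; last by apply: Rmult_le_pos; [apply: pos_INR|apply/Rlt_le/Rinv_0_lt_compat].
apply: (Rmult_lt_reg_r (INR N)) => //; rewrite /Rdiv Rmult_assoc Rinv_l ?Rmult_1_r; last lra.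
(* Cover [1, N] by one block more than the integer quotient of N by q. As q <= N, the total is at
   most (eta/3)(N + q) <= (2 eta/3) N. *)
have le1 : INR (count_upto (W_set beta) N) <= eta / 3 * INR q * INR (N %/ q).+1.
  apply: (Rle_trans _ (INR (\sum_(1 <= k < 1 + q * (N %/ q).+1) inW beta k))).
    apply: INR_leq; rewrite count_upto_sum [leqRHS](@big_cat_nat _ _ _ (1 + N)) //= ?leq_addr //.
    by rewrite leq_add2l mulnC ltnW // ltn_ceil.
  by apply: sum_blocks => k k0; apply: Rle_trans (HC q k q0 k0 sep) block.
apply: Rle_lt_trans le1 _; rewrite S_INR.
have h1 : INR q * INR (N %/ q) <= INR N.
  by rewrite -INR_muln; apply: INR_leq; rewrite mulnC leq_trunc_div.
have h2 := INR_leq qN; nra.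
Qed.

End ProgressionFreeDigits.

Theorem theorem6p1 (beta : R) (Hbeta : 1 < beta)
  (Hirr : irrational (ln beta / ln 2)) :
  Un_cv (fun N => INR (count_upto (W_set beta) N) / INR N) 0 /\
  (badly_approximable (ln beta / ln 2) ->
   forall eps : R, 0 < eps ->
   exists C : R, forall N : nat, (1 <= N)%nat ->
     INR (count_upto (W_set beta) N) <= C * Rpower (INR N) eps).
Proof. exact (ProgressionFreeDigits.density_and_count Hbeta Hirr). Qed.
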